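(* Let $T>0$, $\omega_0 = 2\pi/T$, and let $f:\mathbb{R}\to\mathbb{C}$ be a periodic analog signal with period $T$ that is square integrable over one period. For $n\in\mathbb{Z}$ and $t\in\mathbb{R}$ put $x_n(t)=e^{jn\omega_0 t}$ (for fixed $n$, an analog signal in the variable $t$ with period $T$) and $\bar x_t(n)=e^{-jn\omega_0 t}$ (for fixed $t$, a discrete signal in the variable $n$). Define the discrete signal $F:\mathbb{Z}\to\mathbb{C}$ by $$F(n)=\int_{-T/2}^{T/2} f(\tau)e^{-jn\omega_0\tau}\,d\tau = T C_n,$$ where $C_n=\frac1T\int_{-T/2}^{T/2}f(\tau)e^{-jn\omega_0\tau}\,d\tau$ are the Fourier coefficients of $f$, and assume that $\sum_{n\in\mathbb{Z}}|F(n)|<\infty$. Then $$(f\circledast x_n)(t)=F(n)\,x_n(t)\qquad\text{for all } n\in\mathbb{Z},\ t\in\mathbb{R},$$ and $$(F*\bar x_t)(n)=T f(t)\,\bar x_t(n)\qquad\text{for all } n\in\mathbb{Z}\text{ and almost every } t\in\mathbb{R}.$$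
   Context: Here $j$ is the imaginary unit. An analog signal is a function $\mathbb{R}\to\mathbb{C}$ (measurable) and a discrete signal is a function $\mathbb{Z}\to\mathbb{C}$. For analog signals $f,g$ with the same period $T$, the periodic convolution is $(f\circledast g)(t)=\int_{-T/2}^{T/2}f(\tau)g(t-\tau)\,d\tau$. For discrete signals $f,g$, the convolution is $(f*g)(k)=\sum_{n=-\infty}^{\infty}f(n)g(k-n)$, where the series is required to converge absolutely. *)

(* Defs.v *)
From HB Require Import structures.
From mathcomp Require Import all_boot all_order all_algebra.
From mathcomp Require Import all_classical all_reals all_analysis.
From mathcomp Require Export complex.

Set Implicit Arguments.
Unset Strict Implicit.
Unset Printing Implicit Defensive.

Import Order.TTheory GRing.Theory Num.Theory.
Import numFieldNormedType.Exports.

Local Open Scope classical_set_scope.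
Local Open Scope complex_scope.
Local Open Scope ring_scope.

(* [complex.v] provides the modulus of a complex number as a real number. *)
Notation normc := ComplexField.Normc.normc.

(* R equipped with the sigma-algebra of Lebesgue measurable sets (and not only
   of Borel sets, which is what [measurable] means on the type R itself);
   it is convertible to R. *)
Notation lebesgueR R := (caratheodory_type (@wlength R idfun)^*%mu).

Notation Leb := completed_lebesgue_measure.

Section complex_analysis.
Context {R : realType}.

Definition cexp (z : R[i]) : R[i] :=
  (expR (complex.Re z))%:C * (cos (complex.Im z) +i* sin (complex.Im z)).

Definition analog_measurable (f : R -> R[i]) : Prop :=
  measurable_fun [set: lebesgueR R] (fun t => complex.Re (f t)) /\
  measurable_fun [set: lebesgueR R] (fun t => complex.Im (f t)).

Definition square_integrable (D : set R) (f : R -> R[i]) : Prop :=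
  (\int[Leb]_(t in D) ((normc (f t)) ^+ 2)%:E < +oo)%E.

Definition cintegral (D : set R) (f : R -> R[i]) : R[i] :=
  (\int[Leb]_(t in D) complex.Re (f t)) +i*
  (\int[Leb]_(t in D) complex.Im (f t)).

Definition clim (u : nat -> R[i]) : R[i] :=
  limn (fun n => complex.Re (u n) : R) +i* limn (fun n => complex.Im (u n) : R).

Definition abs_summable (a : int -> R[i]) : Prop :=
  summable [set: int] (fun n => (normc (a n))%:E).

(* Sum over n >= 0 plus sum over n < 0 ([Posz k] is k and [Negz k] is
   - (k + 1)); the value is only meaningful when [a] is [abs_summable]. *)
Definition zsum (a : int -> R[i]) : R[i] :=
  clim (fun N => \sum_(0 <= k < N) a (Posz k)) +
  clim (fun N => \sum_(0 <= k < N) a (Negz k)).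

End complex_analysis.

Section signals.
Context {R : realType}.
Variable T : R.

Definition one_period : set R := `[- T / 2, T / 2].

(* Periodic convolution of analog signals of period T. *)
Definition pconv (f g : R -> R[i]) (t : R) : R[i] :=
  cintegral one_period (fun tau => f tau * g (t - tau)).

Definition omega0 : R := 2 * pi / T.

Definition expsig (n : int) (t : R) : R[i] :=
  cexp ('i%C * (n%:~R * omega0 * t)%:C).

Definition expsig_bar (t : R) (n : int) : R[i] :=
  cexp (- ('i%C * (n%:~R * omega0 * t)%:C)).

Definition fourier (f : R -> R[i]) (n : int) : R[i] :=
  cintegral one_period
    (fun tau => f tau * cexp (- ('i%C * (n%:~R * omega0 * tau)%:C))).

Definition fourier_coef (f : R -> R[i]) (n : int) : R[i] :=
  (T^-1)%:C * cintegral one_period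
    (fun tau => f tau * cexp (- ('i%C * (n%:~R * omega0 * tau)%:C))).

Lemma fourierE (f : R -> R[i]) (n : int) :
  0 < T -> fourier f n = T%:C * fourier_coef f n.
Proof.
move=> T0; rewrite /fourier_coef mulrA -rmorphM/= divff ?gt_eqF//.
by rewrite rmorph1 mul1r.
Qed.

End signals.

(* Convolution of discrete signals; it is meaningful at k when the family
   [fun n => f n * g (k - n)] is [abs_summable]. *)
Definition dconv {R : realType} (f g : int -> R[i]) (k : int) : R[i] :=
  zsum (fun n => f n * g (k - n)).

(* Main.v *)
Require Import Defs.
From HB Require Import structures.
From mathcomp Require Import all_boot all_order all_algebra.
From mathcomp Require Import all_classical all_reals all_analysis.
From mathcomp Require Import measurable_realfun.
From mathcomp Require Import ring lra.

Import Order.TTheory GRing.Theory Num.Theory.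
Import numFieldNormedType.Exports.

Local Open Scope classical_set_scope.
Local Open Scope complex_scope.
Local Open Scope ring_scope.

Set Implicit Arguments.
Unset Strict Implicit.
Unset Printing Implicit Defensive.

(** The first identity holds because an exponential turns the convolution into
a product: x_n (t - tau) = x_n t * x_n (- tau), and x_n t comes out of the
integral. Likewise the discrete convolution at n of F with the conjugate
exponentials at t is the conjugate exponential times
S t = sum over m of F m * x_m t, so that the second identity says that
S t = T * f t for almost every t: the Fourier series of f, which converges
absolutely, has sum f almost everywhere.

On one period this is a uniqueness theorem applied to T * f - S. The partial
sums of S are bounded uniformly in t by the sum of the |F n|; dominated
convergence and the orthogonality of the exponentials ([cintegral_expsig])
therefore give S the same Fourier coefficients as T * f
([fourier_of_series]). Hence all the Fourier coefficients of T * f - S vanish,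
and a square integrable function on a bounded interval is integrable, so it
remains to see that an integrable function on a period is zero almost
everywhere when its Fourier coefficients are ([fourier_uniqueness]).

The real and imaginary parts u of such a function are orthogonal to all real
trigonometric polynomials. The indicator of a ray, restricted to the period,
is almost everywhere the limit of trigonometric polynomials with values in
[0, 1]: the function sin ((omega0 / 2) * (t - a)) *
sin ((omega0 / 2) * (T / 2 - t)) is a trigonometric polynomial that is
positive on the right of a and negative on its left, and the polynomials
(1 - ((1 - s) / 2) ^ n) ^ (2 ^ n) converge on [-1, 1] to 1 for s > 0 and
to 0 for s < 0, by two forms of Bernoulli's inequality. By dominated
convergence the integral of u over every ray is zero
([integral_orthogonal_ray]); a pi-lambda argument extends this to all Borel
sets, and then to all Lebesgue sets since these are Borel sets up to null sets
([ae_eq0_of_rays]). So u is zero almost everywhere.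

Both T * f and S have period T and null sets are invariant under translation,
which carries the equality from one period to the whole line
([ae_periodic]). *)

Local Notation Re := complex.Re.
Local Notation Im := complex.Im.
Arguments expsig : simpl never.

(** * Complex exponentials *)

Section Re_Im.
Context {R : rcfType}.
Implicit Types x y : R[i].

Lemma ReD x y : Re (x + y) = Re x + Re y. Proof. by case: x y => a b []. Qed.
Lemma ImD x y : Im (x + y) = Im x + Im y. Proof. by case: x y => a b []. Qed.
Lemma ReM x y : Re (x * y) = Re x * Re y - Im x * Im y.
Proof. by case: x y => a b []. Qed.
Lemma ImM x y : Im (x * y) = Re x * Im y + Im x * Re y.
Proof. by case: x y => a b []. Qed.
Lemma complex_ext x y : Re x = Re y -> Im x = Im y -> x = y.
Proof. by case: x y => a b [c d] /= -> ->. Qed.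
End Re_Im.

Section exponentials.
Context {R : realType} (T : R).
Implicit Types (m n : int) (s t : R).

Lemma expsigE n t : expsig T n t =
  cos (n%:~R * omega0 T * t) +i* sin (n%:~R * omega0 T * t).
Proof.
rewrite /expsig /cexp; set x := _ * t.
by rewrite /= !(mul0r, mul1r, mulr0, subr0, add0r, addr0) oppr0 expR0 mul1r.
Qed.

Lemma cexp_expsigN n t :
  cexp (- ('i%C * (n%:~R * omega0 T * t)%:C)) = expsig T (- n) t.
Proof. by rewrite /expsig rmorphN !mulNr rmorphN mulrN. Qed.

Lemma expsig_barE n t : expsig_bar T t n = expsig T (- n) t.
Proof. exact: cexp_expsigN. Qed.

Lemma expsig0 t : expsig T 0 t = 1.
Proof. by rewrite expsigE !mul0r cos0 sin0. Qed.

Lemma expsigDn m n t : expsig T (m + n) t = expsig T m t * expsig T n t.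
Proof.
rewrite !expsigE rmorphD/= !mulrDl cosD sinD.
by apply: complex_ext => //=; ring.
Qed.

Lemma expsigDt n s t : expsig T n (s + t) = expsig T n s * expsig T n t.
Proof.
rewrite !expsigE mulrDr cosD sinD.
by apply: complex_ext => //=; ring.
Qed.

Lemma expsigNt n t : expsig T n (- t) = expsig T (- n) t.
Proof. by rewrite !expsigE rmorphN/= !mulNr mulrN. Qed.

Lemma normc_expsig n t : normc (expsig T n t) = 1.
Proof. by rewrite expsigE /= cos2Dsin2 sqrtr1. Qed.

Lemma normcM_expsig (c : R[i]) n t : normc (c * expsig T n t) = normc c.
Proof. by rewrite Normc.normcM normc_expsig mulr1. Qed.

Lemma periodic_expsig n : T != 0 -> periodic (expsig T n) T.
Proof.
move=> T0 t; rewrite expsigDt.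
suff -> : expsig T n T = 1 by rewrite mulr1.
have e1 : expsig T 1 T = 1.
  by rewrite expsigE mul1r divfK// mulr_natl cos2pi sin2pi.
elim: n => [|n IH|n IH].
- exact: expsig0.
- by rewrite intS expsigDn e1 IH mulr1.
- have := expsigDn (- n.+1%:Z) 1 T; rewrite e1 mulr1 => <-.
  by rewrite -IH intS opprD addrAC addNr add0r.
Qed.

Lemma continuous_Re_expsig n : continuous (fun t => Re (expsig T n t)).
Proof.
have -> : (fun t => Re (expsig T n t)) = (fun t => cos (n%:~R * omega0 T * t)).
  by apply/funext => t; rewrite expsigE.
move=> t; apply: (@continuous_comp _ _ _ ( *%R (n%:~R * omega0 T)) cos).
  exact: mulrl_continuous.
exact: continuous_cos.
Qed.

Lemma continuous_Im_expsig n : continuous (fun t => Im (expsig T n t)).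
Proof.
have -> : (fun t => Im (expsig T n t)) = (fun t => sin (n%:~R * omega0 T * t)).
  by apply/funext => t; rewrite expsigE.
move=> t; apply: (@continuous_comp _ _ _ ( *%R (n%:~R * omega0 T)) sin).
  exact: mulrl_continuous.
exact: continuous_sin.
Qed.

Lemma Re_expsig_le1 n t : `|Re (expsig T n t)| <= 1.
Proof. by rewrite expsigE cos_max. Qed.

Lemma Im_expsig_le1 n t : `|Im (expsig T n t)| <= 1.
Proof. by rewrite expsigE sin_max. Qed.

End exponentials.

(** * Lebesgue measurable sets and Borel sets *)

Section lebesgue_sets.
Context {R : realType}.

Lemma borel_lebesgueR (A : set R) :
  measurable A -> measurable (A : set (lebesgueR R)).
Proof. exact: sub_caratheodory. Qed.

(** Seen as a map between the two sigma-algebras, the identity transfers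
measurability and integrals from Borel functions to Lebesgue functions. *)
Lemma measurable_id_lebesgueR :
  measurable_fun [set: lebesgueR R] (idfun : lebesgueR R -> measurableTypeR R).
Proof. by move=> _ B mB; rewrite setTI; exact: borel_lebesgueR. Qed.

Lemma continuous_lebesgueR (f : R -> R) :
  continuous f -> measurable_fun [set: lebesgueR R] f.
Proof.
move=> cf; have mf := continuous_measurable_fun cf.
exact: (measurableT_comp mf measurable_id_lebesgueR).
Qed.

Lemma measurable_one_period (T : R) :
  measurable (one_period T : set (lebesgueR R)).
Proof. by apply: borel_lebesgueR; exact: measurable_itv. Qed.

(** Lebesgue measurable sets differ from Borel sets by null sets; the null set
itself is taken to be Borel. *)
Lemma lebesgueR_borel_part (E : set (lebesgueR R)) : measurable E ->
  exists X A : set R, [/\ measurable X, measurable A, lebesgue_measure A = 0%E,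
    X `<=` E & E `<=` X `|` A].
Proof.
move=> mE.
have : (completed_algebra_gen (@lebesgue_measure R)).-sigma.-measurable E.
  by rewrite completed_caratheodory_measurable.
rewrite g_sigma_completed_algebra_genE => -[/= X mX [N [A [mA A0 NA]] <-]].
exists X, A; split; [exact: mX|exact: mA|exact: A0|by move=> x; left|].
by move=> x [Xx|/NA]; [left|right].
Qed.

End lebesgue_sets.

(** * Complex integrals *)

Section complex_integral.
Context {R : realType}.
Variable D : set (lebesgueR R).
Hypothesis mD : measurable D.
Implicit Types (f g : R -> R[i]) (c : R[i]).

Definition cintegrable f :=
  Leb.-integrable D (EFin \o (fun t => Re (f t))) /\
  Leb.-integrable D (EFin \o (fun t => Im (f t))).

Lemma cintegrableD f g : cintegrable f -> cintegrable g -> cintegrable (f \+ g).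
Proof.
move=> [f1 f2] [g1 g2]; split.
- have := integrableD mD f1 g1; apply: eq_integrable => // t _ /=.
  by rewrite /= ?(ReD, ImD).
- have := integrableD mD f2 g2; apply: eq_integrable => // t _ /=.
  by rewrite /= ?(ReD, ImD).
Qed.

Lemma cintegralD f g : cintegrable f -> cintegrable g ->
  cintegral D (f \+ g) = cintegral D f + cintegral D g.
Proof.
move=> [f1 f2] [g1 g2]; apply: complex_ext => /=.
- rewrite -RintegralD//; apply: eq_Rintegral => t _.
  by rewrite /= ?(ReD, ImD).
- rewrite -RintegralD//; apply: eq_Rintegral => t _.
  by rewrite /= ?(ReD, ImD).
Qed.

Lemma cintegrableZ c f : cintegrable f -> cintegrable (fun t => c * f t).
Proof.
case: c => a b [f1 f2]; split.
- have := integrableB mD (integrableZl mD a f1) (integrableZl mD b f2).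
  by apply: eq_integrable => // t _ /=; rewrite ?ReM ?ImM.
- have := integrableD mD (integrableZl mD a f2) (integrableZl mD b f1).
  by apply: eq_integrable => // t _ /=; rewrite ?ReM ?ImM.
Qed.

Lemma cintegralZ c f : cintegrable f ->
  cintegral D (fun t => c * f t) = c * cintegral D f.
Proof.
case: c => a b [f1 f2].
have iZ r u : Leb.-integrable D (EFin \o u) ->
    Leb.-integrable D (EFin \o (fun t => r * u t)).
  by move=> iu; exact: (integrableZl mD r iu).
apply: complex_ext => /=.
- rewrite -!RintegralZl// -RintegralB//; [|exact: iZ..].
  by apply: eq_Rintegral => t _ /=; rewrite ?ReM ?ImM.
- rewrite -!RintegralZl// -RintegralD//; [|exact: iZ..].
  by apply: eq_Rintegral => t _ /=; rewrite ?ReM ?ImM.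
Qed.

Lemma integrableM_bounded (u v : R -> R) (M : R) :
  Leb.-integrable D (EFin \o u) -> measurable_fun [set: lebesgueR R] v ->
  (forall t, `|v t| <= M) -> Leb.-integrable D (EFin \o (fun t => u t * v t)).
Proof.
move=> iu mv vM; apply: (@integrableMl _ _ _ _ _ mD _ _ iu).
  exact: measurable_funS mv.
exists M; split; first exact: num_real.
by move=> y My x Dx; exact: le_trans (vM x) (ltW My).
Qed.

Lemma cintegrableM_expsig (T : R) (n : int) f : cintegrable f ->
  cintegrable (fun t => f t * expsig T n t).
Proof.
move=> [f1 f2].
have mre := continuous_lebesgueR (@continuous_Re_expsig R T n).
have mim := continuous_lebesgueR (@continuous_Im_expsig R T n).
have re1 := Re_expsig_le1 T n.
have im1 := Im_expsig_le1 T n.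
split.
- have := integrableB mD (integrableM_bounded f1 mre re1)
    (integrableM_bounded f2 mim im1).
  by apply: eq_integrable => // t _ /=; rewrite ?ReM ?ImM.
- have := integrableD mD (integrableM_bounded f1 mim im1)
    (integrableM_bounded f2 mre re1).
  by apply: eq_integrable => // t _ /=; rewrite ?ReM ?ImM.
Qed.

End complex_integral.

(** * Integrals over one period *)

Section period_integrals.
Context {R : realType} (T : R).
Hypothesis T_gt0 : 0 < T.
Let D : set (lebesgueR R) := one_period T.
Let mD : measurable D := measurable_one_period T.

Let ltTT : - T / 2 < T / 2.
Proof. by move: T_gt0 => T0; lra. Qed.

Lemma Leb_one_period : Leb D = T%:E.
Proof.
transitivity (lebesgue_measure (one_period T)); first by [].
by rewrite lebesgue_measure_itv /= lte_fin ltTT -EFinB; congr EFin; field.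
Qed.

Lemma integrable_bounded_period (v : R -> R) (M : R) :
  measurable_fun [set: lebesgueR R] v ->
  (forall t, `|v t| <= M) -> Leb.-integrable D (EFin \o v).
Proof.
move=> mv vM; apply: measurable_bounded_integrable => //.
- by rewrite [X in (X < _)%E]Leb_one_period ltry.
- exact: measurable_funS mv.
- exists M; split; first exact: num_real.
  by move=> y My x Dx; exact: le_trans (vM x) (ltW My).
Qed.

Lemma integrable_cst_period (k : R) : Leb.-integrable D (EFin \o cst k).
Proof. exact: (@integrable_bounded_period (cst k) `|k|). Qed.

(** Each part of f is at most 1 + |f|^2 in absolute value, and the constant 1 is
integrable on a bounded interval. *)
Lemma square_cintegrable (f : R -> R[i]) : analog_measurable f ->
  square_integrable D f -> cintegrable D f.
Proof.
move=> [m1 m2] f2.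
have nE t : normc (f t) ^+ 2 = Re (f t) ^+ 2 + Im (f t) ^+ 2.
  by case: (f t) => a b /=; rewrite sqr_sqrtr// addr_ge0 ?sqr_ge0.
have mn : measurable_fun [set: lebesgueR R] (fun t => normc (f t) ^+ 2).
  by under eq_fun do rewrite nE; apply: measurable_funD; exact: measurable_funX.
have in2 : Leb.-integrable D (EFin \o (fun t => normc (f t) ^+ 2)).
  apply/integrableP; split.
    by apply/measurable_EFinP; exact: measurable_funS mn.
  rewrite (eq_integral (fun t : lebesgueR R => (normc (f t) ^+ 2)%:E)).
    exact: f2.
  by move=> t _; rewrite /= ger0_norm ?sqr_ge0.
have i12 := integrableD mD (integrable_cst_period 1) in2.
have aux x y : `|x| <= 1 + (x ^+ 2 + y ^+ 2) :> R.
  have <- : `|x| ^+ 2 = x ^+ 2 by rewrite real_normK ?num_real.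
  have := sqr_ge0 (`|x| - 1 / 2); have := sqr_ge0 y; nra.
split.
- apply: (le_integrable mD _ _ i12).
    by apply/measurable_EFinP; exact: measurable_funS m1.
  move=> t _ /=; rewrite lee_fin; apply: le_trans (ler_norm _).
  by rewrite nE aux.
- apply: (le_integrable mD _ _ i12).
    by apply/measurable_EFinP; exact: measurable_funS m2.
  move=> t _ /=; rewrite lee_fin; apply: le_trans (ler_norm _).
  by rewrite nE (addrC (_ ^+ 2)) aux.
Qed.

(** The two measures agree on Borel sets, so pushing the completed measure
forward along the identity reduces the claim to the Borel Lebesgue integral. *)
Lemma Rintegral_FTC (F g : R -> R) (M : R) : continuous g ->
  (forall t, `|g t| <= M) ->
  (forall t : R, is_derive t (1 : R) F (g t)) ->
  \int[Leb]_(t in D) g t = F (T / 2) - F (- T / 2).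
Proof.
move=> cg gM Fg.
have mg := continuous_lebesgueR cg.
have ig := integrable_bounded_period mg gM.
have mid := @measurable_id_lebesgueR R.
have mgE : measurable_fun [set: measurableTypeR R] (EFin \o g).
  by apply/measurable_EFinP; exact: continuous_measurable_fun.
have := integral_pushforward mid mgE ig (measurable_itv _).
rewrite /Rintegral => /= <-.
rewrite (_ : (\int[_]_(y in _) _)%E =
    (\int[lebesgue_measure]_(y in one_period T) (g y)%:E)%E); last first.
  exact: eq_measure_integral.
have cF : continuous F.
  move=> t; apply: differentiable_continuous; apply/derivable1_diffP.
  exact: ex_derive.
rewrite (@continuous_FTC2 R g F) //.
- exact: continuous_subspaceT.
- split.
  + by move=> t _; exact: ex_derive.
  + by apply: cvg_at_right_filter; exact: cF.
  + by apply: cvg_at_left_filter; exact: cF.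
- by move=> t _; rewrite derive1E; apply: derive_val.
Qed.

(** For n <> 0 the primitive of x_n is a multiple of x_n itself, hence takes
equal values at the two ends of the period. *)
Lemma cintegral_expsig (n : int) :
  cintegral D (expsig T n) = if n == 0 then T%:C else 0.
Proof.
have T0 : T != 0 by rewrite gt_eqF.
case: eqP => [->|/eqP n0].
  apply: complex_ext => /=.
    transitivity (\int[Leb]_(t in D) cst (1 : R) t).
      by apply: eq_Rintegral => t _; exact: (congr1 (@Re R) (expsig0 T t)).
    by rewrite Rintegral_cst// [X in fine X]Leb_one_period mul1r.
  transitivity (\int[Leb]_(t in D) cst (0 : R) t).
    by apply: eq_Rintegral => t _; exact: (congr1 (@Im R) (expsig0 T t)).
  by rewrite Rintegral_cst// mul0r.
set c := n%:~R * omega0 T.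
have c0 : c != 0.
  rewrite mulf_neq0 ?intr_eq0//.
  by rewrite mulf_neq0 ?invr_eq0 ?mulf_neq0 ?gt_eqF ?pi_gt0.
have per : expsig T n (T / 2) = expsig T n (- T / 2).
  by rewrite -[RHS](periodic_expsig n T0); congr expsig; field.
have dc (t : R) : is_derive t (1 : R) (fun t => c * t) c.
  by apply: is_derive_eq; exact: mulr1.
apply: complex_ext => /=.
- have dF (t : R) : is_derive t (1 : R) (fun t => c^-1 * Im (expsig T n t))
      (Re (expsig T n t)).
    under eq_fun do rewrite expsigE /=.
    apply: is_derive_eq.
    by rewrite expsigE/= /GRing.scale/= mulrCA mulVf// mulr1.
  have cr := @continuous_Re_expsig R T n.
  rewrite (Rintegral_FTC cr (@Re_expsig_le1 R T n) dF).
  by rewrite per subrr.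
- have dF (t : R) : is_derive t (1 : R) (fun t => - c^-1 * Re (expsig T n t))
      (Im (expsig T n t)).
    under eq_fun do rewrite expsigE /=.
    apply: is_derive_eq.
    by rewrite expsigE/= /GRing.scale/= !mulNr mulrN opprK mulrCA mulVf// mulr1.
  have ci := @continuous_Im_expsig R T n.
  rewrite (Rintegral_FTC ci (@Im_expsig_le1 R T n) dF).
  by rewrite per subrr.
Qed.
End period_integrals.

(** * Trigonometric polynomials *)

Section trigonometric_polynomials.
Context {R : realType} (T : R).

Inductive trig_poly : (R -> R[i]) -> Prop :=
| trig_poly_expsig (c : R[i]) (n : int) : trig_poly (fun t => c * expsig T n t)
| trig_polyD p q : trig_poly p -> trig_poly q -> trig_poly (fun t => p t + q t).

Lemma trig_poly_cst c : trig_poly (fun=> c).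
Proof.
rewrite (_ : (fun=> c) = fun t => c * expsig T 0 t).
  exact: trig_poly_expsig.
by apply/funext => t; rewrite expsig0 mulr1.
Qed.

Lemma trig_polyM p q : trig_poly p -> trig_poly q ->
  trig_poly (fun t => p t * q t).
Proof.
move=> + tq; elim=> [c n|p1 p2 _ IH1 _ IH2]; last first.
  by under eq_fun do rewrite mulrDl; exact: trig_polyD.
elim: tq => [d m|q1 q2 _ IH1 _ IH2]; last first.
  by under eq_fun do rewrite mulrDr; exact: trig_polyD.
by under eq_fun do rewrite mulrACA -expsigDn; exact: trig_poly_expsig.
Qed.

Lemma trig_polyX p k : trig_poly p -> trig_poly (fun t => p t ^+ k).
Proof.
move=> tp; elim: k => [|k IH]; first exact: trig_poly_cst.
by under eq_fun do rewrite exprS; exact: trig_polyM.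
Qed.

Lemma trig_poly_cos (a : R) :
  trig_poly (fun t => (cos (omega0 T * (t - a)))%:C).
Proof.
rewrite (_ : (fun t => _) =
    fun t => (2^-1)%:C * expsig T 1 (- a) * expsig T 1 t +
             (2^-1)%:C * expsig T (-1) (- a) * expsig T (-1) t).
  by apply: trig_polyD; exact: trig_poly_expsig.
apply/funext => t.
rewrite -(mulrA _ (expsig T 1 _)) -(mulrA _ (expsig T (-1) _)) -!expsigDt.
rewrite (addrC (- a)).
have -> : expsig T (-1) (t - a) = (expsig T 1 (t - a))^*%C.
  by rewrite !expsigE /= !mulNr cosN sinN.
rewrite expsigE mul1r; apply: complex_ext => /=; [by field|ring].
Qed.

Lemma sin_mul_sin (x y : R) : sin x * sin y = (cos (x - y) - cos (x + y)) / 2.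
Proof. by rewrite cosB cosD; field. Qed.

(** A trigonometric polynomial of degree 1, although each of its factors has
half the fundamental frequency; on a period containing a and b it is positive
exactly between a and b. *)
Definition arc_sign (a b t : R) : R :=
  sin (omega0 T / 2 * (t - a)) * sin (omega0 T / 2 * (b - t)).

Lemma trig_poly_arc_sign a b : trig_poly (fun t => (arc_sign a b t)%:C).
Proof.
rewrite (_ : (fun t => _) = fun t =>
   (2^-1)%:C * (cos (omega0 T * (t - (a + b) / 2)))%:C +
   (- (2^-1) * cos (omega0 T / 2 * (b - a)))%:C).
  apply: trig_polyD; last exact: trig_poly_cst.
  by apply: trig_polyM; [exact: trig_poly_cst|exact: trig_poly_cos].
apply/funext => t; rewrite /arc_sign sin_mul_sin -mulrDr -mulrBr.
rewrite -rmorphM -rmorphD/=; congr (_ %:C).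
rewrite mulrBl mulNr [cos _ / 2]mulrC [cos _ / 2]mulrC.
by congr (_ * cos _ - _ * cos _); field.
Qed.

Lemma arc_sign_bound a b t : `|arc_sign a b t| <= 1.
Proof. by rewrite normrM mulr_ile1// sin_max. Qed.

End trigonometric_polynomials.

(** * Polynomial approximation of a step *)

Section step_polynomials.
Context {R : realType}.
Implicit Types (s x : R) (n : nat).

(** The Brosowski-Deutsch polynomials: with y = (1 - s) / 2, the product
2^n * y^n tends to 0 when y < 1/2 and to infinity when y > 1/2. *)
Definition step_poly n s : R := (1 - ((1 - s) / 2) ^+ n) ^+ (2 ^ n).

Lemma bernoulli_le n x : 0 <= x <= 1 -> 1 - x *+ n <= (1 - x) ^+ n.
Proof.
move=> /andP[x0 x1]; elim: n => [|n IH]; first by rewrite mulr0n subr0.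
rewrite exprS mulrSr.
have h : (1 - x) * (1 - x *+ n) <= (1 - x) * (1 - x) ^+ n.
  by rewrite ler_wpM2l// subr_ge0.
apply: le_trans h.
have : 0 <= x * (x *+ n) by rewrite mulr_ge0// mulrn_wge0.
lra.
Qed.

(** The bound (1 - x)^n <= (1 + x)^-n combined with (1 + x)^n >= 1 + n x. *)
Lemma bernoulli_ge n x : 0 <= x <= 1 -> (1 - x) ^+ n * (1 + x *+ n) <= 1.
Proof.
move=> /andP[x0 x1]; elim: n => [|n IH]; first by rewrite mulr0n addr0 mul1r.
apply: le_trans IH; rewrite exprS -mulrA mulrCA ler_wpM2l//.
  by rewrite exprn_ge0// subr_ge0.
have : 0 <= x * (x *+ n) by rewrite mulr_ge0// mulrn_wge0.
have := sqr_ge0 x.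
rewrite mulrSr; nra.
Qed.

Lemma step_poly_arg n s : `|s| <= 1 -> 0 <= ((1 - s) / 2) ^+ n <= 1.
Proof.
rewrite ler_norml => /andP[s1 s2].
have h : 0 <= (1 - s) / 2 by lra.
by rewrite exprn_ge0// exprn_ile1//; lra.
Qed.

Lemma step_poly_itv n s : `|s| <= 1 -> 0 <= step_poly n s <= 1.
Proof.
move=> /(step_poly_arg n) /andP[h0 h1].
by rewrite exprn_ge0 ?exprn_ile1 ?subr_ge0//; lra.
Qed.

Let step_arg_scale n s : ((1 - s) / 2) ^+ n *+ 2 ^ n = (1 - s) ^+ n.
Proof. by rewrite expr_div_n -mulr_natr natrX divfK// expf_neq0. Qed.

Lemma step_poly_cvg1 s : 0 < s <= 1 -> step_poly ^~ s @ \oo --> (1 : R).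
Proof.
move=> /andP[s0 s1].
have s1' : `|s| <= 1 by rewrite ger0_norm// ltW.
apply: (@squeeze_cvgr _ _ _ _ (fun n => 1 - (1 - s) ^+ n) (fun=> 1)).
- apply: nearW => n; have /andP[_ ->] := step_poly_itv n s1'; rewrite andbT.
  by rewrite -step_arg_scale bernoulli_le// step_poly_arg.
- rewrite -[X in _ --> X]subr0; apply: cvgB; first exact: cvg_cst.
  by apply: cvg_expr; rewrite ger0_norm; lra.
- exact: cvg_cst.
Qed.

Lemma step_poly_cvg0 s : -1 <= s < 0 -> step_poly ^~ s @ \oo --> (0 : R).
Proof.
move=> /andP[s0 s1].
have s1' : `|s| <= 1 by rewrite ler_norml; lra.
apply: (@squeeze_cvgr _ _ _ _ (fun=> 0) (fun n => (1 - s)^-1 ^+ n)).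
- apply: nearW => n; have /andP[-> _] /= := step_poly_itv n s1'.
  have z0 : 0 < 1 - s by lra.
  rewrite exprVn -[leRHS]mul1r ler_pdivlMr ?exprn_gt0//.
  apply: le_trans (bernoulli_ge (2 ^ n) (step_poly_arg n s1')).
  rewrite step_arg_scale ler_wpM2l ?ler_wpDl//.
  by have /andP[] := step_poly_itv n s1'.
- exact: cvg_cst.
- apply: cvg_expr; rewrite ger0_norm ?invr_ge0; last by lra.
  by rewrite invf_lt1; lra.
Qed.

End step_polynomials.

(** * Sign of [arc_sign] on one period *)

Section sign.
Context {R : realType} (T : R).
Hypothesis T_gt0 : 0 < T.

Let sin_half_gt0 (x : R) : 0 < x < T -> 0 < sin (omega0 T / 2 * x).
Proof.
move=> /andP[x0 xT]; apply: sin_gt0_pi.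
have -> : omega0 T / 2 * x = pi * (x / T).
  by rewrite /omega0; field; rewrite gt_eqF.
by rewrite mulr_gt0 ?divr_gt0 ?pi_gt0//= gtr_pMr ?pi_gt0// ltr_pdivrMr// mul1r.
Qed.

Lemma arc_sign_gt0 (a t : R) : - T / 2 <= a -> a < t -> t < T / 2 ->
  0 < arc_sign T a (T / 2) t.
Proof.
move=> aT aa tb.
by apply: mulr_gt0; apply: sin_half_gt0; move: T_gt0 => T0; lra.
Qed.

Lemma arc_sign_lt0 (a t : R) : a < T / 2 -> - T / 2 < t -> t < a ->
  arc_sign T a (T / 2) t < 0.
Proof.
move=> aT tT ta; rewrite /arc_sign -opprB mulrN sinN mulNr oppr_lt0.
by apply: mulr_gt0; apply: sin_half_gt0; move: T_gt0 => T0; lra.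
Qed.
End sign.

(** * Functions with zero integral on every ray *)

Section ae_zero.
Context {R : realType} (D : set (lebesgueR R)) (u : R -> R).
Hypothesis mD : measurable D.
Hypothesis iu : Leb.-integrable D (EFin \o u).

(** The sets over which the integral vanishes form a lambda-system, and the rays
form a pi-system that generates the Borel sets. *)
Lemma integral_borel_eq0 :
  (\int[Leb]_(x in D) (u x)%:E = 0)%E ->
  (forall a : R, \int[Leb]_(x in D `&` `]a, +oo[) (u x)%:E = 0)%E ->
  forall B : set R, measurable B -> (\int[Leb]_(x in D `&` B) (u x)%:E = 0)%E.
Proof.
move=> uD uray B.
have mDB (S : set R) : measurable S -> measurable (D `&` S).
  by move=> mS; apply: measurableI => //; exact: borel_lebesgueR.
have muS (S : set (lebesgueR R)) : S `<=` D -> measurable S ->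
    Leb.-integrable S (EFin \o u).
  by move=> SD mS; apply: integrableS iu.
pose P (S : set (measurableTypeR R)) :=
  (\int[Leb]_(x in D `&` S) (u x)%:E = 0)%E.
have mG := RGenOInfty.measurableE R.
move=> mB; have := mB; rewrite [X in X B -> _]mG; clear mB.
apply: (@dynkin_induction _ (measurableTypeR R) _ P mG).
- move=> _ _ [a ->] [b ->]; exists (Num.max a b).
  apply/seteqP; split => x /=; rewrite !in_itv/= !andbT gt_max.
    by move=> [-> ->].
  by move/andP.
- by rewrite /P setIT.
- by move=> _ [a ->]; exact: uray.
- move=> S mS PS; have := uD.
  have DE : D = (D `&` S) `|` (D `&` ~` S) by rewrite -setIUr setUv setIT.
  rewrite {1}DE integral_setU.
  + by rewrite [X in (X + _)%E]PS add0e.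
  + exact: mDB.
  + by apply: mDB; exact: measurableC.
  + by rewrite -DE; exact: (measurable_int _ iu).
  + by apply/disj_setPS; rewrite setIACA setICr setI0.
- move=> F mF tF PF; rewrite /P setI_bigcupr integral_bigcup.
  + by apply: eseries0 => k _ _; exact: PF.
  + exact: trivIset_setIl.
  + by move=> k; apply: mDB; exact: mF.
  + apply: muS; first by move=> x [k _ []].
    by apply: bigcupT_measurable => k; apply: mDB; exact: mF.
Qed.

(** A Lebesgue set is a Borel set up to a null set, so the integral vanishes
over all Lebesgue subsets of D, in particular over those where u has a sign. *)
Lemma ae_eq0_of_rays :
  (\int[Leb]_(x in D) (u x)%:E = 0)%E ->
  (forall a : R, \int[Leb]_(x in D `&` `]a, +oo[) (u x)%:E = 0)%E ->
  {ae Leb, forall x : lebesgueR R, D x -> u x = 0}.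
Proof.
move=> uD uray; have uB := integral_borel_eq0 uD uray.
have : ae_eq Leb D (EFin \o u) (cst 0%E).
  apply: integral_ae_eq => // E ED mE.
  rewrite integral0.
  have [X [A [mX mA A0 XE EXA]]] := lebesgueR_borel_part mE.
  have mA' := borel_lebesgueR mA.
  have mX' := borel_lebesgueR mX.
  rewrite (negligible_integral mA' mE)//; last exact: integrableS iu.
  rewrite (_ : E `\` A = X `\` A); last first.
    by apply/seteqP; split => x [] /=; [move/EXA => []|move/XE].
  rewrite -(negligible_integral mA' mX')//; last first.
    by apply: integrableS iu => //; exact: subset_trans ED.
  rewrite -(uB _ mX) setIidr//; exact: subset_trans ED.
by apply: filterS => x /= ux Dx; have [] := ux Dx.
Qed.
End ae_zero.

(** * Uniqueness of Fourier coefficients *)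

Section uniqueness.
Context {R : realType} (T : R).
Hypothesis T_gt0 : 0 < T.
Let D : set (lebesgueR R) := one_period T.
Let mD : measurable D := measurable_one_period T.

Lemma cintegral_trig_poly f p : cintegrable D f ->
  (forall n, cintegral D (fun t => f t * expsig T n t) = 0) -> trig_poly T p ->
  cintegrable D (fun t => f t * p t) /\ cintegral D (fun t => f t * p t) = 0.
Proof.
move=> fi f0; elim=> [c n|{}p q _ [pi p0] _ [qi q0]].
- have fe := cintegrableM_expsig mD T n fi.
  under eq_fun do rewrite mulrCA.
  by split; [exact: cintegrableZ|rewrite cintegralZ// f0 mulr0].
- under eq_fun do rewrite mulrDr.
  split; first exact: (cintegrableD mD pi qi).
  by rewrite (cintegralD mD pi qi) p0 q0 addr0.
Qed.

(** The products u * r are required to be integrable so that the equation with 0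
is about a genuine integral. *)
Definition trig_orthogonal (u : R -> R) := forall r : R -> R,
  trig_poly T (fun t => (r t)%:C) ->
  Leb.-integrable D (EFin \o (fun t => u t * r t)) /\
  (\int[Leb]_(t in D) (u t * r t)%:E = 0)%E.

(** The indicator of the ray is the bounded pointwise limit of the trigonometric
polynomials [step_poly n \o arc_sign T a (T / 2)], except at a and at the two
ends of the period. *)
Lemma integral_orthogonal_ray (u : R -> R) (a : R) :
  Leb.-integrable D (EFin \o u) -> trig_orthogonal u ->
  - T / 2 <= a -> a < T / 2 ->
  (\int[Leb]_(t in D) (u t * \1_`]a, +oo[ t)%:E = 0)%E.
Proof.
move=> iu ou aT aT'.
pose s := arc_sign T a (T / 2).
have s1 t : `|s t| <= 1 by exact: arc_sign_bound.
have os n : trig_poly T (fun t => (step_poly n (s t))%:C).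
  rewrite (_ : (fun t => _) = fun t =>
      (1 + (- 1) * ((2^-1)%:C + (- (2^-1)%:C) * (s t)%:C) ^+ n) ^+ (2 ^ n)).
    apply/trig_polyX/trig_polyD; first exact: trig_poly_cst.
    apply: trig_polyM; first exact: trig_poly_cst.
    apply/trig_polyX/trig_polyD; first exact: trig_poly_cst.
    by apply: trig_polyM; [exact: trig_poly_cst|exact: trig_poly_arc_sign].
  apply/funext => t; rewrite /step_poly rmorphXn; congr (_ ^+ _).
  rewrite rmorphB rmorph1 mulN1r rmorphXn; congr (_ - _ ^+ _).
  by rewrite mulrC mulrBr mulr1 rmorphB rmorphM/= mulNr.
have cvs (t : lebesgueR R) :
    (t != - T / 2)%R -> (t != a)%R -> (t != T / 2)%R -> D t ->
    (u t * step_poly n (s t))%:E @[n --> \oo] --> (u t * \1_`]a, +oo[ t)%:E.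
  move=> t1 ta t2; rewrite /D /one_period /= in_itv/= => /andP[Tt tT].
  apply: cvg_EFin; first exact: nearW.
  apply: cvgM; first exact: cvg_cst.
  rewrite indicE.
  have [ta'|ta'|/eqP] := ltgtP a t; last by rewrite eq_sym (negPf ta).
  - rewrite mem_set/= ?in_itv/= ?ta'//; apply: step_poly_cvg1.
    rewrite arc_sign_gt0// ?lt_neqAle ?t2//=.
    by have := s1 t; rewrite ler_norml => /andP[].
  - rewrite memNset/=; last first.
      by rewrite in_itv/= andbT; apply/negP; rewrite -leNgt ltW.
    apply: step_poly_cvg0; rewrite (@arc_sign_lt0 _ _ T_gt0 a)//= ?andbT.
      by have := s1 t; rewrite ler_norml => /andP[].
    by rewrite lt_neqAle eq_sym t1.
have neg (x : R) : Leb.-negligible ([set x] : set (lebesgueR R)).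
  exists [set x]; split => //; first exact: borel_lebesgueR.
  exact: lebesgue_measure_set1.
have mu1 : measurable_fun D (EFin \o u) := measurable_int _ iu.
have [|||||_ _] := @dominated_convergence _ _ _ Leb D mD
   (fun n t => (u t * step_poly n (s t))%:E)
   (fun t => (u t * \1_`]a, +oo[ t)%:E) (fun t => `|u t|%:E).
- by move=> n; have [/measurable_int] := ou _ (os n).
- apply/measurable_EFinP; apply: measurable_funM; first exact/measurable_EFinP.
  by apply: measurable_indic; apply: borel_lebesgueR; exact: measurable_itv.
- have := negligibleU (negligibleU (neg (- T / 2)) (neg a)) (neg (T / 2)).
  apply: negligibleS => t /= /not_implyP [Dt ncv].
  apply: contrapT => tn; apply: ncv.
  by apply: cvs => //; apply/eqP => te; apply: tn; tauto.
- exact: integrable_abse iu.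
- apply: aeW => t n _; rewrite lee_fin normrM ler_piMr//.
  by have /andP[h0 h1] := step_poly_itv n (s1 t); rewrite ger0_norm.
rewrite [X in X @ \oo --> _](_ : _ = fun=> 0%E).
  by move/cvg_lim => <- //; rewrite lim_cst.
by apply/funext => n; have [_] := ou _ (os n).
Qed.

Lemma trig_orthogonal_ae0 (u : R -> R) :
  Leb.-integrable D (EFin \o u) -> trig_orthogonal u ->
  {ae Leb, forall x : lebesgueR R, D x -> u x = 0}.
Proof.
move=> iu ou.
have uD : (\int[Leb]_(x in D) (u x)%:E = 0)%E.
  have [_ <-] := ou (fun=> 1) (trig_poly_cst T 1).
  by apply: eq_integral => t _; rewrite mulr1.
apply: ae_eq0_of_rays => // a.
have [aT|aT] := ltP a (- T / 2).
  rewrite setIidl// => t.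
  rewrite /D /one_period /= !in_itv/= andbT => /andP[+ _].
  exact: lt_le_trans.
have [aT'|aT'] := ltP a (T / 2); last first.
  rewrite (_ : _ `&` _ = set0) ?integral_set0//.
  rewrite -subset0 => t [].
  rewrite /D /one_period /= !in_itv/= andbT => /andP[_ tT].
  by move/lt_le_trans => /(_ _ tT); rewrite ltNge aT'.
rewrite -[RHS](integral_orthogonal_ray iu ou aT aT') integral_mkcondr.
apply: eq_integral => t _; rewrite patchE indicE.
by case: ifP => _; rewrite ?mulr1 ?mulr0.
Qed.

Lemma fourier_uniqueness (f : R -> R[i]) : cintegrable D f ->
  (forall n, cintegral D (fun t => f t * expsig T n t) = 0) ->
  {ae Leb, forall t : lebesgueR R, D t -> f t = 0}.
Proof.
move=> fi f0.
have fp r := cintegral_trig_poly fi f0 (p := fun t => (r t)%:C).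
have ou1 : trig_orthogonal (fun t => Re (f t)).
  move=> r /fp [[i1 _] /(congr1 (@Re R)) /= z].
  have E : (fun t => Re (f t * (r t)%:C)) = (fun t => Re (f t) * r t).
    by apply/funext => t; rewrite ReM/= mulr0 subr0.
  rewrite E in i1; rewrite E in z; split => //.
  by rewrite -[LHS]fineK ?(integrable_fin_num _ i1)//; congr EFin.
have ou2 : trig_orthogonal (fun t => Im (f t)).
  move=> r /fp [[_ i1] /(congr1 (@Im R)) /= z].
  have E : (fun t => Im (f t * (r t)%:C)) = (fun t => Im (f t) * r t).
    by apply/funext => t; rewrite ImM/= mulr0 add0r.
  rewrite E in i1; rewrite E in z; split => //.
  by rewrite -[LHS]fineK ?(integrable_fin_num _ i1)//; congr EFin.
have h1 := trig_orthogonal_ae0 fi.1 ou1.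
have h2 := trig_orthogonal_ae0 fi.2 ou2.
apply: filterS2 h1 h2 => t h1 h2 Dt.
by apply: complex_ext; [rewrite h1|rewrite h2].
Qed.
End uniqueness.

(** * Translation invariance *)

Section translation.
Context {R : realType}.

Lemma lebesgue_measure_shift (c : R) (A : set R) : measurable A ->
  lebesgue_measure ((fun x => x + c) @^-1` A) = lebesgue_measure A.
Proof.
have mc : measurable_fun [set: measurableTypeR R]
    ((fun x => x + c) : measurableTypeR R -> measurableTypeR R).
  apply: continuous_measurable_fun => x.
  by apply: cvgD; [exact: cvg_id|exact: cvg_cst].
move=> mA; rewrite -[LHS]/(pushforward lebesgue_measure
  ((fun x => x + c) : measurableTypeR R -> measurableTypeR R) A).
apply/esym/lebesgue_measure_unique => //= _ [[a b]] _ <-.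
rewrite /pushforward (_ : _ @^-1` _ = `](a - c), (b - c)]%classic); last first.
  by apply/seteqP; split => x /=; rewrite !in_itv/= ltrBlDr lerBrDr.
by rewrite !lebesgue_measure_itv/= !lte_fin ltrD2r -!EFinB opprB addrA subrK.
Qed.

Lemma negligible_shift (c : R) (N : set (lebesgueR R)) :
  Leb.-negligible N -> Leb.-negligible ((fun x : R => x + c) @^-1` N).
Proof.
move=> [A [mA A0 NA]].
have [X [B [mX mB B0 XA AXB]]] := lebesgueR_borel_part mA.
have mX' := borel_lebesgueR mX.
have X0 : lebesgue_measure X = 0%E.
  apply/eqP; rewrite eq_le measure_ge0 andbT -A0.
  by apply: (@le_measure _ _ _ Leb); rewrite ?inE.
have sh0 (S : set R) : measurable S -> lebesgue_measure S = 0%E ->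
    Leb.-negligible ((fun x : R => x + c) @^-1` S : set (lebesgueR R)).
  move=> mS S0; exists ((fun x : R => x + c) @^-1` S); split => //.
  - apply: borel_lebesgueR; rewrite -[X in measurable X]setTI.
    apply: (continuous_measurable_fun _ measurableT mS) => x.
    by apply: cvgD; [exact: cvg_id|exact: cvg_cst].
  - by rewrite -[RHS]S0; exact: lebesgue_measure_shift.
apply: negligibleS (negligibleU (sh0 _ mX X0) (sh0 _ mB B0)).
by move=> x /NA /AXB.
Qed.
End translation.

(** * Absolutely summable families indexed by the integers *)

Section series.
Context {R : realType}.
Implicit Types (u v : nat -> R[i]) (a b : int -> R[i]) (c l : R[i]).

Definition ccvg u l :=
  Re (u n) @[n --> \oo] --> Re l /\ Im (u n) @[n --> \oo] --> Im l.

Lemma ccvg_unique u l l' : ccvg u l -> ccvg u l' -> l = l'.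
Proof.
move=> [h1 h2] [k1 k2]; apply: complex_ext.
  by rewrite -(cvg_lim (@Rhausdorff R) h1) -(cvg_lim (@Rhausdorff R) k1).
by rewrite -(cvg_lim (@Rhausdorff R) h2) -(cvg_lim (@Rhausdorff R) k2).
Qed.

Lemma ccvgZ c u l : ccvg u l -> ccvg (fun n => c * u n) (c * l).
Proof.
move=> [h1 h2]; split.
- under eq_fun do rewrite ReM.
  by rewrite ReM; apply: cvgB; apply: cvgM => //; exact: cvg_cst.
- under eq_fun do rewrite ImM.
  by rewrite ImM; apply: cvgD; apply: cvgM => //; exact: cvg_cst.
Qed.

(** Cutting the two half-sums of [zsum] at the same N makes the sum over the
integers a single limit. *)
Definition zpartial a (N : nat) : R[i] :=
  \sum_(0 <= k < N) (a (Posz k) + a (Negz k)).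

Lemma zpartialS a N :
  zpartial a N.+1 = zpartial a N + (a (Posz N) + a (Negz N)).
Proof. by rewrite /zpartial big_nat_recr. Qed.

Lemma zpartialZ c a N : zpartial (fun n => c * a n) N = c * zpartial a N.
Proof.
by rewrite /zpartial mulr_sumr; apply: eq_bigr => k _; rewrite mulrDr.
Qed.

Lemma Re_sum (I : Type) (s : seq I) (F : I -> R[i]) :
  Re (\sum_(i <- s) F i) = \sum_(i <- s) Re (F i).
Proof. by elim/big_rec2: _ => // i x y _ <-; rewrite ReD. Qed.

Lemma Im_sum (I : Type) (s : seq I) (F : I -> R[i]) :
  Im (\sum_(i <- s) F i) = \sum_(i <- s) Im (F i).
Proof. by elim/big_rec2: _ => // i x y _ <-; rewrite ImD. Qed.

Lemma abs_Re_le_normc c : `|Re c| <= normc c.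
Proof. by case: c => x y /=; rewrite -sqrtr_sqr ler_wsqrtr// lerDl sqr_ge0. Qed.

Lemma abs_Im_le_normc c : `|Im c| <= normc c.
Proof. by case: c => x y /=; rewrite -sqrtr_sqr ler_wsqrtr// lerDr sqr_ge0. Qed.

Lemma abs_summable_cvg (e : nat -> int) a : injective e -> abs_summable a ->
  cvgn (series (fun k => normc (a (e k)))).
Proof.
move=> ei sa.
have sn : summable [set: nat] (fun k => (normc (a (e k)))%:E).
  apply: le_lt_trans sa.
  rewrite -(@esum_image _ _ _ [set: nat] e (fun n => `|(normc (a n))%:E|)%E);
    last by move=> x y _ _; exact: ei.
  rewrite esum_mkcond; apply: le_esum => i _.
  by case: ifP => // _; rewrite abse_ge0.
have n0 k : (0 <= (normc (a (e k)))%:E)%E.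
  rewrite lee_fin.
  exact: (le_trans (normr_ge0 _) (abs_Re_le_normc (a (e k)))).
apply: (@summable_cvg R xpredT (fun k => (normc (a (e k)))%:E)) => [k _|].
  exact: n0.
by rewrite [X in summable X _](_ : _ = [set: nat])//; apply/seteqP; split.
Qed.

Lemma cvg_series_dominated (w : nat -> R) (v : nat -> R) :
  cvgn (series v) -> (forall n, `|w n| <= v n) -> cvgn (series w).
Proof.
move=> cv wv; apply: (@normed_cvg _ R).
apply: (series_le_cvg _ _ wv cv) => n; first exact: normr_ge0.
exact: le_trans (normr_ge0 _) (wv n).
Qed.

Lemma ccvg_series (w : nat -> R[i]) : cvgn (series (fun k => normc (w k))) ->
  ccvg (fun N => \sum_(0 <= k < N) w k) (clim (fun N => \sum_(0 <= k < N) w k)).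
Proof.
move=> cw.
have reE : (fun N => Re (\sum_(0 <= k < N) w k)) = series (fun k => Re (w k)).
  by apply/funext => N; rewrite Re_sum.
have imE : (fun N => Im (\sum_(0 <= k < N) w k)) = series (fun k => Im (w k)).
  by apply/funext => N; rewrite Im_sum.
split; rewrite /clim /= ?reE ?imE.
- exact: (cvg_series_dominated cw (fun k => abs_Re_le_normc (w k))).
- exact: (cvg_series_dominated cw (fun k => abs_Im_le_normc (w k))).
Qed.

Lemma ccvgD u v l l' : ccvg u l -> ccvg v l' -> ccvg (u \+ v) (l + l').
Proof.
move=> [h1 h2] [k1 k2]; split.
- by under eq_fun do rewrite ReD; rewrite ReD; exact: cvgD.
- by under eq_fun do rewrite ImD; rewrite ImD; exact: cvgD.
Qed.

Lemma abs_summable_Posz a : abs_summable a ->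
  cvgn (series (fun k => normc (a (Posz k)))).
Proof. by apply: abs_summable_cvg => x y []. Qed.

Lemma abs_summable_Negz a : abs_summable a ->
  cvgn (series (fun k => normc (a (Negz k)))).
Proof. by apply: abs_summable_cvg => x y []. Qed.

Lemma zpartial_cvg a : abs_summable a -> ccvg (zpartial a) (zsum a).
Proof.
move=> sa; rewrite (_ : zpartial a =
    (fun N => \sum_(0 <= k < N) a (Posz k)) \+
    (fun N => \sum_(0 <= k < N) a (Negz k))).
  by apply: ccvgD; apply: ccvg_series;
    [exact: abs_summable_Posz|exact: abs_summable_Negz].
by apply/funext => N; rewrite /zpartial big_split.
Qed.

(** The bound M depends on the moduli of a alone; for the Fourier series it is
thus uniform in t, as dominated convergence requires. *)
Lemma zpartial_bounded a : abs_summable a -> exists M, forall b N,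
  (forall n, normc (b n) = normc (a n)) ->
  `|Re (zpartial b N)| <= M /\ `|Im (zpartial b N)| <= M.
Proof.
move=> sa.
have n0 n : 0 <= normc (a n) := le_trans (normr_ge0 _) (abs_Re_le_normc (a n)).
have le_lim (e : nat -> int) : cvgn (series (fun k => normc (a (e k)))) ->
    forall N, \sum_(0 <= k < N) normc (a (e k)) <=
              limn (series (fun k => normc (a (e k)))).
  move=> cv N.
  by apply: (nondecreasing_cvgn_le _ cv); exact: nondecreasing_series.
have bP := le_lim _ (abs_summable_Posz sa).
have bN := le_lim _ (abs_summable_Negz sa).
exists (limn (series (fun k => normc (a (Posz k)))) +
        limn (series (fun k => normc (a (Negz k))))) => b N ab.
have bound (w : int -> R) : (forall n, `|w n| <= normc (b n)) ->
  `|\sum_(0 <= k < N) (w (Posz k) + w (Negz k))| <=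
    limn (series (fun k => normc (a (Posz k)))) +
    limn (series (fun k => normc (a (Negz k)))).
  move=> wb; apply: le_trans (lerD (bP N) (bN N)).
  rewrite -big_split/=; apply: le_trans (ler_norm_sum _ _ _) _.
  apply: ler_sum => k _; apply: le_trans (ler_normD _ _) _.
  by rewrite -!ab lerD.
split; rewrite /zpartial ?Re_sum ?Im_sum.
- under eq_bigr do rewrite ReD.
  exact: (bound (fun n => Re (b n)) (fun n => abs_Re_le_normc (b n))).
- under eq_bigr do rewrite ImD.
  exact: (bound (fun n => Im (b n)) (fun n => abs_Im_le_normc (b n))).
Qed.

Lemma eq_abs_summable a b : (forall n, normc (b n) = normc (a n)) ->
  abs_summable a -> abs_summable b.
Proof. by move=> ab; rewrite /abs_summable; under eq_fun do rewrite -ab. Qed.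

Lemma zsumZ c a : abs_summable a -> abs_summable (fun n => c * a n) ->
  zsum (fun n => c * a n) = c * zsum a.
Proof.
move=> sa sca; apply: (ccvg_unique (zpartial_cvg sca)).
have -> : zpartial (fun n => c * a n) = fun N => c * zpartial a N.
  by apply/funext => N; exact: zpartialZ.
exact/ccvgZ/zpartial_cvg.
Qed.
End series.

(** * Fourier inversion *)

Section fourier_series.
Context {R : realType} (T : R).
Hypothesis T_gt0 : 0 < T.
Let D : set (lebesgueR R) := one_period T.
Let mD : measurable D := measurable_one_period T.

Lemma cintegrable_expsig n : cintegrable D (expsig T n).
Proof.
have i1 : cintegrable D (fun=> 1) by split; exact: integrable_cst_period.
have := cintegrableM_expsig mD T n i1.
by under eq_fun do rewrite mul1r.
Qed.

Lemma bounded_convergence (w : nat -> R -> R) (v : R -> R) (M : R) :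
  (forall n, Leb.-integrable D (EFin \o w n)) ->
  (forall n t, `|w n t| <= M) -> (forall t, w n t @[n --> \oo] --> v t) ->
  Leb.-integrable D (EFin \o v) /\
  \int[Leb]_(t in D) w n t @[n --> \oo] --> \int[Leb]_(t in D) v t.
Proof.
move=> iw wM wv.
have mw n := measurable_int _ (iw n).
have wv' (t : lebesgueR R) : D t -> (w n t)%:E @[n --> \oo] --> (v t)%:E.
  by move=> _; apply: cvg_EFin; [exact: nearW|exact: wv].
have mv : measurable_fun D (EFin \o v).
  exact: (@emeasurable_fun_cvg _ _ _ D (fun n t => (w n t)%:E) _ mw wv').
have [|||iv _ cv] := @dominated_convergence _ _ _ Leb D mD
    (fun n t => (w n t)%:E) (EFin \o v) (EFin \o cst M) mw mv.
- exact: aeW.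
- exact: (integrable_cst_period T_gt0).
- by apply: aeW => t n _; rewrite lee_fin.
split; first exact: iv.
apply: fine_cvg; rewrite fineK; first exact: cv.
exact: integrable_fin_num iv.
Qed.

Lemma cbounded_convergence (w : nat -> R -> R[i]) (v : R -> R[i]) (M : R) :
  (forall n, cintegrable D (w n)) ->
  (forall n t, `|Re (w n t)| <= M /\ `|Im (w n t)| <= M) ->
  (forall t, ccvg (w ^~ t) (v t)) ->
  cintegrable D v /\ ccvg (fun n => cintegral D (w n)) (cintegral D v).
Proof.
move=> iw wM wv.
have [i1 c1] := bounded_convergence (fun n => (iw n).1) (fun n t => (wM n t).1)
  (fun t => (wv t).1).
have [i2 c2] := bounded_convergence (fun n => (iw n).2) (fun n t => (wM n t).2)
  (fun t => (wv t).2).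
by [].
Qed.

Lemma cintegrable_zpartial (a : int -> R -> R[i]) N :
  (forall n, cintegrable D (a n)) ->
  cintegrable D (fun t => zpartial (a ^~ t) N) /\
  cintegral D (fun t => zpartial (a ^~ t) N) =
    zpartial (fun n => cintegral D (a n)) N.
Proof.
move=> ia; elim: N => [|N [IH1 IH2]].
  rewrite /zpartial; under eq_fun do rewrite big_nil.
  rewrite big_nil; have i0 := integrable_cst_period T_gt0 0.
  split; first by split.
  by apply: complex_ext; rewrite /= Rintegral_cst// mul0r.
have ipn := cintegrableD mD (ia (Posz N)) (ia (Negz N)).
have -> : (fun t => zpartial (a ^~ t) N.+1) =
   (fun t => zpartial (a ^~ t) N) \+ (a (Posz N) \+ a (Negz N)).
  by apply/funext => t; rewrite zpartialS.
split; first exact: cintegrableD.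
by rewrite zpartialS (cintegralD mD)// IH2 (cintegralD mD).
Qed.

Lemma zpartial_delta (c : int -> R[i]) (d : R[i]) (k : int) (N : nat) :
  (`|k| < N)%N ->
  zpartial (fun n => c n * (if n - k == 0 then d else 0)) N = c k * d.
Proof.
move=> kN; rewrite /zpartial.
under eq_bigr do rewrite !subr_eq0 !(fun_if ( *%R _)) !mulr0.
rewrite big_split /=; case: k kN => k /= kN.
  rewrite [X in _ + X]big1 ?addr0; last by [].
  by under eq_bigr do rewrite eqz_nat; rewrite -big_mkcond/= big_nat1_eq kN.
rewrite [X in X + _]big1 ?add0r; last by [].
have E i : (Negz i == Negz k) = (i == k) by apply/eqP/eqP => [[]|->].
by under eq_bigr do rewrite E; rewrite -big_mkcond/= big_nat1_eq (ltnW kN).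
Qed.

(** The partial sums are bounded uniformly in t, so the integral may be taken
term by term; by orthogonality the N-th partial sum already contributes
c k * T as soon as N > |k|. *)
Lemma fourier_of_series (c : int -> R[i]) (k : int) : abs_summable c ->
  let S t := zsum (fun n => c n * expsig T n t) in
  cintegrable D S /\ cintegral D (fun t => S t * expsig T (- k) t) = c k * T%:C.
Proof.
move=> sc S.
have [M bM] := zpartial_bounded sc.
have normE m t n : normc (c n * expsig T (n - m) t) = normc (c n).
  by rewrite Normc.normcM normc_expsig mulr1.
have sE m t : abs_summable (fun n => c n * expsig T (n - m) t).
  exact: eq_abs_summable (normE m t) sc.
have iE m n : cintegrable D (fun t => c n * expsig T (n - m) t).
  exact/(cintegrableZ mD)/cintegrable_expsig.
have SE m t : S t * expsig T (- m) t = zsum (fun n => c n * expsig T (n - m) t).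
  have s1 n : c n * expsig T (n - m) t =
      expsig T (- m) t * (c n * expsig T n t).
    by rewrite expsigDn mulrA mulrC.
  under [in RHS]eq_fun do rewrite s1.
  rewrite zsumZ; first by rewrite mulrC.
    by have := sE 0 t; under eq_fun do rewrite subr0.
  by under eq_fun do rewrite -s1; exact: sE.
have conv m := @cbounded_convergence
  (fun N t => zpartial (fun n => c n * expsig T (n - m) t) N)
  (fun t => S t * expsig T (- m) t) M
  (fun N => (cintegrable_zpartial N (iE m)).1)
  (fun N t => bM _ N (normE m t)).
have lim m t : ccvg (zpartial (fun n => c n * expsig T (n - m) t))
    (S t * expsig T (- m) t).
  by rewrite SE; apply: zpartial_cvg; exact: sE.
split.
  have [+ _] := conv 0 (lim 0).
  by under eq_fun do rewrite oppr0 expsig0 mulr1.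
have [_ cv] := conv k (lim k).
apply: (ccvg_unique cv).
have E N : (`|k| < N)%N ->
    cintegral D (fun t => zpartial (fun n => c n * expsig T (n - k) t) N) =
    c k * T%:C.
  move=> kN; rewrite (cintegrable_zpartial N (iE k)).2.
  rewrite -(@zpartial_delta c T%:C k N kN).
  rewrite /zpartial; apply: eq_bigr => i _.
  have i1 n : cintegrable D (expsig T n) := cintegrable_expsig n.
  by rewrite !(cintegralZ mD)// !(cintegral_expsig T_gt0).
split; apply: cvg_near_cst; exists `|k|.+1 => // N /= kN.
- exact: (congr1 (@Re R) (E N kN)).
- exact: (congr1 (@Im R) (E N kN)).
Qed.

Lemma fourier_inversion (f : R -> R[i]) : cintegrable D f ->
  abs_summable (fourier T f) ->
  {ae Leb, forall t : lebesgueR R,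
    D t -> T%:C * f t - zsum (fun n => fourier T f n * expsig T n t) = 0}.
Proof.
move=> fi sF.
set S := fun t => zsum (fun n => fourier T f n * expsig T n t).
have Si : cintegrable D S := (fourier_of_series 0 sF).1.
have Tfi := cintegrableZ mD T%:C fi.
have NSi := cintegrableZ mD (- 1) Si.
apply: (@fourier_uniqueness _ T T_gt0 (fun t => T%:C * f t - S t)).
  rewrite (_ : (fun t => _) = (fun t => T%:C * f t) \+ (fun t => - 1 * S t)).
    exact: cintegrableD.
  by apply/funext => t; rewrite /= mulN1r.
move=> n.
have -> : (fun t => (T%:C * f t - S t) * expsig T n t) =
    (fun t => T%:C * (f t * expsig T n t)) \+
    (fun t => - 1 * (S t * expsig T n t)).
  by apply/funext => t /=; rewrite mulrBl mulrA mulN1r.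
have fe := cintegrableM_expsig mD T n fi.
have Se := cintegrableM_expsig mD T n Si.
rewrite (cintegralD mD (cintegrableZ mD _ fe) (cintegrableZ mD _ Se)).
rewrite (cintegralZ mD _ fe) (cintegralZ mD _ Se).
have := (fourier_of_series (- n) sF).2; rewrite opprK => ->.
rewrite mulN1r; apply/eqP; rewrite subr_eq0 mulrC; apply/eqP; congr (_ * _).
rewrite /fourier; congr cintegral; apply/funext => t.
by rewrite cexp_expsigN opprK.
Qed.

(** The exceptional set is covered by the translates, by multiples of T, of the
exceptional set of one period. *)
Lemma ae_periodic (h : R -> R[i]) : periodic h T ->
  {ae Leb, forall t : lebesgueR R, D t -> h t = 0} ->
  {ae Leb, forall t : lebesgueR R, h t = 0}.
Proof.
move=> hT h0; pose N : set (lebesgueR R) := ~` [set t | D t -> h t = 0].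
have N0 : Leb.-negligible N by exact: h0.
have hTn n a : h (a - T *+ n) = h a.
  by rewrite -[in RHS](subrK (T *+ n) a) (periodicn hT).
have cover : ~` [set t : lebesgueR R | h t = 0] `<=`
    \bigcup_k ((fun x : R => x + T *+ k) @^-1` N `|`
               (fun x : R => x + - (T *+ k)) @^-1` N).
  move=> t /= ht.
  pose x := (t + T / 2) / T.
  have xE : t = x * T - T / 2 by rewrite /x; field; rewrite gt_eqF.
  (* k is the number of the period that contains t: the one of [one_period T]
     has number 0 and starts at - T / 2. *)
  have [k kx] : exists k : int, k%:~R <= x < k%:~R + 1.
    by exists (Num.floor x); rewrite floor_le -[1]/(1%:~R) -intrD floorD1_gt.
  have : D (t - k%:~R * T).
    rewrite /D /one_period /= in_itv/=; move: kx => /andP[k1 k2].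
    rewrite {1 2}xE; move: T_gt0 => T0; apply/andP; split; nra.
  case: k {kx} => k Dt.
  - exists k => //; right => /= h1; apply: ht; rewrite -(hTn k).
    by apply: h1; rewrite -mulr_natl; exact: Dt.
  - exists k.+1 => //; left => /= h1; apply: ht; rewrite -(periodicn hT k.+1).
    apply: h1; move: Dt; rewrite NegzE rmorphN/= mulNr opprK.
    by rewrite -mulr_natl; exact.
apply: negligibleS cover _; apply: negligible_bigcup => k.
by apply: negligibleU; exact: negligible_shift.
Qed.
End fourier_series.

Theorem proposition3p1 (R : realType) (T : R) (f : R -> R[i])
    (T_gt0 : 0 < T)
    (f_meas : analog_measurable f)
    (f_per : periodic f T)
    (f_sq : square_integrable (one_period T) f)
    (F_sum : abs_summable (fourier T f)) :
  (forall (n : int) (t : R),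
     pconv T f (expsig T n) t = fourier T f n * expsig T n t) /\
  (forall n : int, {ae Leb, forall t : lebesgueR R,
     abs_summable (fun m : int => fourier T f m * expsig_bar T t (n - m)) /\
     dconv (fourier T f) (expsig_bar T t) n
       = T%:C * f t * expsig_bar T t n}).
Proof.
have fi := square_cintegrable T_gt0 f_meas f_sq.
have mD := measurable_one_period T.
split=> n.
  move=> t; rewrite mulrC /fourier -(cintegralZ mD); last first.
    under eq_fun do rewrite cexp_expsigN.
    exact: cintegrableM_expsig.
  rewrite /pconv; congr cintegral; apply/funext => tau.
  by rewrite cexp_expsigN expsigDt expsigNt; ring.
have hper : periodic (fun t => T%:C * f t -
    zsum (fun m => fourier T f m * expsig T m t)) T.
  move=> t; rewrite f_per; congr (_ - zsum _); apply/funext => m.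
  by rewrite periodic_expsig// gt_eqF.
have := ae_periodic T_gt0 hper (fourier_inversion T_gt0 fi F_sum).
apply: filterS => t /eqP; rewrite subr_eq0 => /eqP fS.
have barE m : fourier T f m * expsig_bar T t (n - m) =
    expsig_bar T t n * (fourier T f m * expsig T m t).
  by rewrite !expsig_barE opprB addrC expsigDn; ring.
have s1 : abs_summable (fun m => fourier T f m * expsig T m t).
  by apply: eq_abs_summable F_sum => m; exact: normcM_expsig.
have s2 : abs_summable (fun m => fourier T f m * expsig_bar T t (n - m)).
  apply: eq_abs_summable F_sum => m; rewrite expsig_barE.
  exact: normcM_expsig.
split; first exact: s2.
have E : (fun m => fourier T f m * expsig_bar T t (n - m)) =
    (fun m => expsig_bar T t n * (fourier T f m * expsig T m t)).
  exact/funext.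
rewrite E in s2.
by rewrite /dconv E (zsumZ s1 s2) -fS mulrC.
Qed.
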